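(* A binary De Morgan function is a protoimplication if and only if it lies in the interval $[x\leftrightarrow_{\mathrm{t\text-min}}y,\ x\rightarrow_{\mathrm{t\text-max}}y]$ of the pointwise truth order, and equivalently if and only if it lies in the interval $[x\leftrightarrow_{\mathrm{i\text-min}}y,\ x\rightarrow_{\mathrm{i\text-max}}y]$ of the pointwise information order.
   Context: Let $\mathrm{DM}_4=\{\mathsf t,\mathsf f,\mathsf n,\mathsf b\}$. The truth order $\le$ has $\mathsf f$ least, $\mathsf t$ greatest, $\mathsf n,\mathsf b$ incomparable. The information order $\sqsubseteq$ has $\mathsf n$ least, $\mathsf b$ greatest, $\mathsf t,\mathsf f$ incomparable. Binary De Morgan functions are maps $\mathrm{DM}_4^2\to\mathrm{DM}_4$, ordered pointwise. A binary De Morgan function $\rightarrow$ is a protoimplication if $a\rightarrow a\in\{\mathsf t,\mathsf b\}$ for all $a$, and $a\in\{\mathsf t,\mathsf b\}$ together with $a\rightarrow b\in\{\mathsf t,\mathsf b\}$ implies $b\in\{\mathsf t,\mathsf b\}$. The four functions are: $a\rightarrow_{\mathrm{t\text-max}}b=\mathsf n$ if $a\in\{\mathsf t,\mathsf b\}$ and $b\in\{\mathsf f,\mathsf n\}$, and $=\mathsf t$ otherwise; $a\rightarrow_{\mathrm{i\text-max}}b=\mathsf f$ if $a\in\{\mathsf t,\mathsf b\}$ and $b\in\{\mathsf f,\mathsf n\}$, and $=\mathsf b$ otherwise; $a\leftrightarrow_{\mathrm{t\text-min}}b=\mathsf b$ if $a=b$ and $\mathsf f$ otherwise; $a\leftrightarrow_{\mathrm{i\text-min}}b=\mathsf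 t$ if $a=b$ and $\mathsf n$ otherwise. *)

(* Defs.v *)
From HB Require Import structures.
From mathcomp Require Import all_boot.

Set Implicit Arguments.
Unset Strict Implicit.
Unset Printing Implicit Defensive.

(* True, false, neither and both. *)
Inductive DM4 := DMt | DMf | DMn | DMb.

(* The Belnap coding of DM4 as pairs (told true, told false) is used only to
   derive the decidable equality; it is Leibniz equality. *)
Definition DM4_code (a : DM4) : bool * bool :=
  match a with
  | DMt => (true, false)
  | DMf => (false, true)
  | DMn => (false, false)
  | DMb => (true, true)
  end.

Definition DM4_decode (c : bool * bool) : DM4 :=
  match c with
  | (true, false) => DMt
  | (false, true) => DMf
  | (false, false) => DMn
  | (true, true) => DMb
  end.

Lemma DM4_codeK : cancel DM4_code DM4_decode.
Proof. by case. Qed.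

HB.instance Definition _ := Equality.copy DM4 (can_type DM4_codeK).

Definition truth_le : rel DM4 := fun a b => [|| a == b, a == DMf | b == DMt].

Definition info_le : rel DM4 := fun a b => [|| a == b, a == DMn | b == DMb].

Lemma truth_le_order :
  [/\ reflexive truth_le, antisymmetric truth_le & transitive truth_le].
Proof. by split; [case | case; case | case; case; case]. Qed.

Lemma info_le_order :
  [/\ reflexive info_le, antisymmetric info_le & transitive info_le].
Proof. by split; [case | case; case | case; case; case]. Qed.

Definition DMfun2 := DM4 -> DM4 -> DM4.

Definition pointwise (le : rel DM4) (g h : DMfun2) : Prop :=
  forall a b, le (g a b) (h a b).

Definition in_interval (le : rel DM4) (lo hi g : DMfun2) : Prop :=
  pointwise le lo g /\ pointwise le g hi.

Definition designated : pred DM4 := fun a => (a == DMt) || (a == DMb).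

Definition protoimplication (imp : DMfun2) : Prop :=
  (forall a, designated (imp a a)) /\
  (forall a b, designated a -> designated (imp a b) -> designated b).

Definition imp_tmax : DMfun2 := fun a b =>
  if (a \in [:: DMt; DMb]) && (b \in [:: DMf; DMn]) then DMn else DMt.

Definition imp_imax : DMfun2 := fun a b =>
  if (a \in [:: DMt; DMb]) && (b \in [:: DMf; DMn]) then DMf else DMb.

Definition iff_tmin : DMfun2 := fun a b => if a == b then DMb else DMf.

Definition iff_imin : DMfun2 := fun a b => if a == b then DMt else DMn.

(* Main.v *)
Require Import Defs.
From mathcomp Require Import all_boot.

(** Both defining conditions constrain each value [imp a b] separately, and only
    through its designation: it must be designated if [a = b], and undesignated
    if [a] is designated and [b] is not. In the truth order the designated values
    form the interval from b to t and the undesignated ones the interval from f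
    to n; in the information order these are [[t, b]] and [[n, f]]. The whole of
    DM4 is [[f, t]], respectively [[n, b]]. *)

Definition proto_value (a b c : DM4) : bool :=
  ((a == b) ==> designated c) &&
  (designated a && ~~ designated b ==> ~~ designated c).

(** Modus ponens enters [proto_value] in contraposed form, which turns it into a condition on the
    single value [imp a b]. *)
Lemma protoimplicationP (imp : DMfun2) :
  protoimplication imp <-> forall a b, proto_value a b (imp a b).
Proof.
split=> [[refl_imp mp_imp] a b | val_imp].
  apply/andP; split; first by apply/implyP=> /eqP <-.
  by apply/implyP=> /andP[Da]; apply/contraNN/mp_imp.
split=> [a | a b Da].
  by have /andP[] := val_imp a a; rewrite eqxx.
by have /andP[_] := val_imp a b; rewrite Da /= => /implyP/contraTT.
Qed.

(** Pointwise bounds also act on each value separately, so [imp] drops out and a finite check over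
    the 64 triples [(a, b, c)] remains. *)
Lemma in_intervalP (le : rel DM4) (lo hi imp : DMfun2) :
    (forall a b c, le (lo a b) c && le c (hi a b) = proto_value a b c) ->
  in_interval le lo hi imp <-> forall a b, proto_value a b (imp a b).
Proof.
move=> E; split=> [[lo_imp imp_hi] a b | val_imp].
  by rewrite -E lo_imp imp_hi.
by split=> a b; have := val_imp a b; rewrite -E => /andP[].
Qed.

(** The bounds on [c] are [DMb] and [DMt] if [a = b], [DMf] and [DMn] if [a] is designated and [b]
    is not, [DMf] and [DMt] otherwise. *)
Lemma truth_interval_value (a b c : DM4) :
  truth_le (iff_tmin a b) c && truth_le c (imp_tmax a b) = proto_value a b c.
Proof. by case: a; case: b; case: c. Qed.

Lemma info_interval_value (a b c : DM4) :
  info_le (iff_imin a b) c && info_le c (imp_imax a b) = proto_value a b c.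
Proof. by case: a; case: b; case: c. Qed.

Theorem mainTheorem12 (imp : DMfun2) :
  (protoimplication imp <-> in_interval truth_le iff_tmin imp_tmax imp) /\
  (protoimplication imp <-> in_interval info_le iff_imin imp_imax imp).
Proof.
split; apply: iff_trans (protoimplicationP imp) (iff_sym _).
  exact/in_intervalP/truth_interval_value.
exact/in_intervalP/info_interval_value.
Qed.
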